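(* Let $\mathbb{F}$ be a field, let $s,n,k\ge1$ be integers, and let $C\subseteq(\mathbb{F}^s)^n$ be an $\mathbb{F}$-linear code with block length $n$, message length $k$ and rate $R=\frac{k}{sn}$. Assume that $C$ is an $\left(\ell,\frac{\ell(k-1)}{s-\ell+1}\right)$-strong subspace designable code for every integer $1\le\ell\le s$. Then for every integer $1\le L\le s$, $C$ is $\left(\frac{L}{L+1}\left(1-\frac{sR}{s-L+1}\right),L\right)$ average-radius list-decodable (in particular, list-decodable with the same parameters).
   Context: Strong subspace design: a collection of $\mathbb{F}$-linear subspaces $H_1,\dots,H_n\subseteq\mathbb{F}^k$ is an $(\ell,A)$ strong subspace design over $\mathbb{F}$ if for every $\mathbb{F}$-linear subspace $W\subseteq\mathbb{F}^k$ of dimension $\ell$ one has $\sum_{i=1}^n\dim_{\mathbb{F}}(H_i\cap W)\le A$. Strong subspace designable code: let $C\subseteq(\mathbb{F}^s)^n$ be an $\mathbb{F}$-linear code with message length $k$ and $\mathbb{F}$-linear encoder $\mathcal{C}:\mathbb{F}^k\to(\mathbb{F}^s)^n$ (with image $C$). For $i\in\{1,\dots,n\}$ let $H_i=\{f\in\mathbb{F}^k:\mathcal{C}(f)_i=0\}$, where $\mathcal{C}(f)_i\in\mathbb{F}^s$ is the $i$-th coordinate. $C$ is $(\ell,A)$-strong subspace designable if $\{H_1,\dots,H_n\}$ is an $(\ell,A)$ strong subspace design. List-decodability: the alphabet is $\Sigma=\mathbb{F}^s$. For $x,y\in\Sigma^n$ let $\delta(x,y)$ be the fraction of coordinates in which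 $x$ and $y$ differ. A code $C\subseteq\Sigma^n$ is $(\rho,L)$ list-decodable if for every $y\in\Sigma^n$ there are at most $L$ codewords $c\in C$ with $\delta(c,y)\le\rho$. It is $(\rho,L)$ average-radius list-decodable if there do not exist $y\in\Sigma^n$ and pairwise distinct $x_1,\dots,x_{L+1}\in C$ with $\frac{1}{L+1}\sum_{i=1}^{L+1}\delta(x_i,y)\le\rho$. (If $\rho<0$ these hold vacuously.) *)

(* Defs.v *)
From HB Require Import structures.
From mathcomp Require Import all_boot all_order all_algebra.

Set Implicit Arguments.
Unset Strict Implicit.
Unset Printing Implicit Defensive.

Import Order.TTheory GRing.Theory Num.Theory.

Local Open Scope ring_scope.

Definition strong_subspace_design (F : fieldType) (n k l : nat) (A : rat)
    (H : 'I_n -> {vspace 'rV[F]_k}) : Prop :=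
  forall W : {vspace 'rV[F]_k}, \dim W = l ->
    (\sum_(i < n) \dim (H i :&: W))%N%:R <= A.

Definition coord_ker (F : fieldType) (s n k : nat)
    (enc : 'Hom('rV[F]_k, {ffun 'I_n -> 'rV[F]_s})) (i : 'I_n) :
    {vspace 'rV[F]_k} :=
  lker (linfun (fun f : 'rV[F]_k => enc f i)).

(* [linfun] is total and only agrees with its argument on linear maps; this
   checks that [coord_ker enc i] is indeed {f | enc(f)_i = 0}. *)
Lemma mem_coord_ker (F : fieldType) (s n k : nat)
    (enc : 'Hom('rV[F]_k, {ffun 'I_n -> 'rV[F]_s})) (i : 'I_n) (f : 'rV[F]_k) :
  (f \in coord_ker enc i) = (enc f i == 0).
Proof.
have lin : linear (fun g : 'rV[F]_k => enc g i).
  by move=> a u v; rewrite linearP !ffunE.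
pose m := GRing.isLinear.Build _ _ _ _ (fun g : 'rV[F]_k => enc g i) lin.
pose e : {linear 'rV[F]_k -> 'rV[F]_s} :=
  HB.pack (fun g : 'rV[F]_k => enc g i) m.
by rewrite memv_ker -[X in linfun X]/(e : _ -> _) lfunE.
Qed.

(* The code is the image [limg enc] of the encoder [enc], which is not
   required to be injective. *)
Definition strong_subspace_designable (F : fieldType) (s n k : nat)
    (enc : 'Hom('rV[F]_k, {ffun 'I_n -> 'rV[F]_s})) (l : nat) (A : rat) :
    Prop :=
  strong_subspace_design l A (coord_ker enc).

Definition rate (s n k : nat) : rat := k%:R / (s%:R * n%:R).

Definition rel_dist (S : eqType) (n : nat) (x y : {ffun 'I_n -> S}) : rat :=
  #|[set i | x i != y i]|%:R / n%:R.

(* The alphabet may be infinite, so "at most L codewords" is expressed by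
   bounding the size of every duplicate-free list of them. *)
Definition list_decodable (S : eqType) (n : nat)
    (C : {pred {ffun 'I_n -> S}}) (rho : rat) (L : nat) : Prop :=
  forall (y : {ffun 'I_n -> S}) (cs : seq {ffun 'I_n -> S}),
    uniq cs ->
    (forall c, c \in cs -> c \in C /\ rel_dist c y <= rho) ->
    (size cs <= L)%N.

Definition avg_radius_list_decodable (S : eqType) (n : nat)
    (C : {pred {ffun 'I_n -> S}}) (rho : rat) (L : nat) : Prop :=
  ~ exists (y : {ffun 'I_n -> S}) (x : 'I_L.+1 -> {ffun 'I_n -> S}),
      [/\ injective x, forall i, x i \in C &
          L.+1%:R^-1 * \sum_(i < L.+1) rel_dist (x i) y <= rho].

(* Main.v *)
Require Import Defs.
From mathcomp Require Import all_boot all_order all_algebra.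
From mathcomp Require Import boolp ring lra.

(* Lift the L+1 codewords to distinct messages f_j, and let S_i be the set of
   codewords agreeing with y at coordinate i: the differences of messages in
   S_i lie in H_i, and a small average radius means that sum_i (|S_i| - 1) is
   large. If the f_j are affinely independent, |S_i| - 1 is at most the
   dimension of H_i inside the span T of the differences, and the design
   property concludes at once. In general one needs a Brascamp-Lieb type
   inequality: if weights p_i >= 0 satisfy
     sum_i p_i dim (V_i :&: U) <= dim U    for every U <= T,
   then sum_i p_i (|S_i| - 1) <= |D| - 1 for every finite set D of points in a
   coset of T and all S_i in D contained in a coset of V_i. Since the conclusion
   is linear in p, weight can be exchanged between two indices without decreasing
   the left-hand side, until some weight vanishes or some proper U becomes tight;
   a tight U splits the problem into the cosets of U and the set of cosets. The
   design property at all dimensions l <= L gives the hypothesis for a constant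
   weight p. *)

Set Implicit Arguments.
Unset Strict Implicit.
Unset Printing Implicit Defensive.

Import Order.TTheory GRing.Theory Num.Theory.

Local Open Scope ring_scope.

(** * Minima over finite data and counting along fibres *)

Lemma ex_min_finite_image (X : Type) (T : finType) (h : X -> T) (g : T -> rat)
    (P : X -> Prop) :
  (exists x, P x) ->
  exists2 x, P x & forall y, P y -> g (h x) <= g (h y).
Proof.
case=> x0 Px0.
pose Q t := `[< exists2 x, P x & h x = t >].
have Qt0 : Q (h x0) by apply/asboolP; exists x0.
case: (@arg_minP _ _ _ (h x0) Q g Qt0) => t /asboolP[x Px <-] tmin.
by exists x => // y Py; apply: tmin; apply/asboolP; exists y.
Qed.

(** Each nonempty fibre loses one point, and there are [#|r @: A|] of them; empty fibres contribute
    0 since [0.-1 = 0]. *)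
Lemma card_fibers_predn (J : finType) (r : J -> J) (A : {set J}) :
  #|A|.-1 = (\sum_j #|A :&: r @^-1: [set j]|.-1 + #|r @: A|.-1)%N.
Proof.
have fib j : (#|A :&: r @^-1: [set j]| =
    #|A :&: r @^-1: [set j]|.-1 + (j \in r @: A))%N.
  case: imsetP => [[a Aa ->]|noA].
    by rewrite addn1 prednK //; apply/card_gt0P; exists a; rewrite !inE Aa /=.
  rewrite addn0; suff -> : A :&: r @^-1: [set j] = set0 by rewrite cards0.
  apply/setP => a; rewrite !inE; apply/negP => /andP[Aa /eqP rj].
  by apply: noA; exists a.
have cA : (#|A| = \sum_j #|A :&: r @^-1: [set j]|.-1 + #|r @: A|)%N.
  have -> : (#|A| = \sum_j #|A :&: r @^-1: [set j]|)%N.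
    rewrite -sum1_card (partition_big r xpredT) //=.
    by apply: eq_bigr => j _; rewrite -sum1_card; apply: eq_bigl => a; rewrite !inE.
  under eq_bigr => j _ do rewrite fib.
  rewrite big_split /=; congr (_ + _)%N.
  by rewrite -sum1_card [RHS]big_mkcond.
rewrite cA; case: (set_0Vmem A) => [->|[a Aa]].
  by rewrite imset0 cards0 addn0 big1 // => j _; rewrite set0I cards0.
have: (0 < #|r @: A|)%N by apply/card_gt0P; exists (r a); exact: imset_f.
by case: #|r @: A| => // m _; rewrite addnS.
Qed.

(** * The weighted incidence inequality *)

Section Incidence.
Variables (K : fieldType) (vT : vectType K) (I J : finType).
Variables (V : I -> {vspace vT}) (f : J -> vT).
Implicit Types (B T U : {vspace vT}) (p : I -> rat) (D : {set J}).

(* Working between B and T instead of in the quotient T / B keeps all points and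
   subspaces in vT when the induction passes to a quotient. *)
Definition gain B U i : rat := (\dim (V i :&: U))%:R - (\dim (V i :&: B))%:R.

(** For [B <= U], [gain B U i] is the dimension of the image of [V i :&: U] in [U / B], so this is
    the Brascamp-Lieb condition for [T / B]. *)
Definition subcritical p B T := forall U, (B <= U)%VS -> (U <= T)%VS ->
  \sum_i p i * gain B U i <= (\dim U)%:R - (\dim B)%:R.

Lemma gain_ge0 B U i : (B <= U)%VS -> 0 <= gain B U i.
Proof. by move=> BU; rewrite subr_ge0 ler_nat dimvS // capvS. Qed.

Lemma gainD B U T i : gain B T i = gain B U i + gain U T i.
Proof. rewrite /gain; ring. Qed.

Lemma subcritical_above p B U T :
    (B <= U)%VS -> subcritical p B T ->
    \sum_i p i * gain B U i = (\dim U)%:R - (\dim B)%:R ->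
  subcritical p U T.
Proof.
move=> BU sc tight U' UU' U'T.
have := sc U' (subv_trans BU UU') U'T.
under eq_bigr => i _ do rewrite (gainD B U) mulrDr.
by rewrite big_split /= tight; lra.
Qed.

(** Test the condition at [(V i :&: T) + B], where the gain of [i] equals the growth in
    dimension. *)
Lemma subcritical_le1 p B T i :
    (forall j, 0 <= p j) -> subcritical p B T -> (B <= T)%VS ->
  0 < gain B T i -> p i <= 1.
Proof.
move=> p0 sc BT gi0.
have BU : (B <= (V i :&: T) + B)%VS by exact: addvSr.
have UT : ((V i :&: T) + B <= T)%VS by rewrite subv_add capvSr.
have := sc _ BU UT; rewrite (bigD1 i) //=.
set rest := \sum_(j | _) _.
have rest0 : 0 <= rest by apply: sumr_ge0 => j _; rewrite mulr_ge0 ?gain_ge0.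
have capE : (V i :&: ((V i :&: T) + B) = V i :&: T)%VS.
  by apply/eqP; rewrite eqEsubv capvS //= subv_cap capvSl addvSl.
have gE : gain B ((V i :&: T) + B) i = gain B T i by rewrite /gain capE.
have dE : (\dim ((V i :&: T) + B))%:R - (\dim B)%:R = gain B T i :> rat.
  have := congr1 (fun m => m%:R : rat) (dimv_sum_cap (V i :&: T) B).
  have -> : (V i :&: T :&: B = V i :&: B)%VS by rewrite -capvA (capv_idPr BT).
  by rewrite /gain /= !natrD; lra.
rewrite gE dE => le.
by rewrite -(ler_pM2r gi0) mul1r; lra.
Qed.

Definition exchange p (i j : I) (a b : rat) (l : I) : rat :=
  p l + (l == i)%:R * a - (l == j)%:R * b.

Lemma sum_exchange p i j a b (w : I -> rat) :
  \sum_l exchange p i j a b l * w l = \sum_l p l * w l + a * w i - b * w j.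
Proof.
have single i0 a0 : \sum_l (l == i0)%:R * a0 * w l = a0 * w i0.
  rewrite (bigD1 i0) //= eqxx mul1r big1 ?addr0 // => l /negbTE ->.
  by rewrite !mul0r.
rewrite -(single i) -(single j) -big_split -sumrB /=.
by apply: eq_bigr => l _; rewrite /exchange; ring.
Qed.

(* Either the weight of j is exhausted, or some subspace becomes tight first;
   the latter lies strictly between B and T because the exchange leaves the
   constraints at B and T unchanged. *)
Lemma exchange_weight p B T i j :
    (forall l, 0 <= p l) -> subcritical p B T -> i != j ->
    0 < gain B T i -> 0 < gain B T j ->
  exists t, let q := exchange p i j (t * gain B T j) (t * gain B T i) in
    [/\ 0 <= t, forall l, 0 <= q l, subcritical q B T &
      q j = 0 \/ exists U, [/\ (B <= U)%VS, (U <= T)%VS,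
        (\dim B < \dim U < \dim T)%N &
        \sum_l q l * gain B U l = (\dim U)%:R - (\dim B)%:R]].
Proof.
move=> p0 sc ij gi0 gj0.
pose slack U : rat := (\dim U)%:R - (\dim B)%:R - \sum_l p l * gain B U l.
(* The speed at which the slack at [U] shrinks as [t] grows; the exchanged amounts make it vanish at
   [B] and at [T]. *)
pose dl U := gain B T j * gain B U i - gain B T i * gain B U j.
have sumq t U :
    \sum_l exchange p i j (t * gain B T j) (t * gain B T i) l * gain B U l
    = (\dim U)%:R - (\dim B)%:R - (slack U - t * dl U).
  by rewrite sum_exchange /slack /dl; ring.
have q0 t : 0 <= t -> t * gain B T i <= p j ->
    forall l, 0 <= exchange p i j (t * gain B T j) (t * gain B T i) l.
  move=> t0 tp l; have tg : 0 <= t * gain B T j by rewrite mulr_ge0 // ltW.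
  rewrite /exchange; case: (eqVneq l i) => [->|_].
    by rewrite (negbTE ij) mul1r mul0r subr0 addr_ge0.
  rewrite mul0r addr0; case: (eqVneq l j) => [->|_].
    by rewrite mul1r subr_ge0.
  by rewrite mul0r subr0.
(* At [t0] the weight of [j] is exhausted; a [bad] subspace is one whose constraint would fail by
   then. *)
pose t0 := p j / gain B T i.
have t0_ge0 : 0 <= t0 by rewrite divr_ge0 // ltW.
have t0E : t0 * gain B T i = p j by rewrite divfK // gt_eqF.
pose bad U := [/\ (B <= U)%VS, (U <= T)%VS & slack U < t0 * dl U].
have slack0 U : (B <= U)%VS -> (U <= T)%VS -> 0 <= slack U.
  by move=> BU UT; rewrite subr_ge0 sc.
have [exbad|nobad] := pselect (exists U, bad U); last first.
  exists t0; split=> //; first by apply: q0; rewrite ?t0E.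
  - move=> U BU UT; rewrite sumq.
    suff : t0 * dl U <= slack U by lra.
    by rewrite leNgt; apply/negP => lt; apply: nobad; exists U.
  - by left; rewrite /exchange eq_sym (negbTE ij) eqxx t0E mul0r mul1r addr0 subrr.
(* The ratios slack U / dl U depend only on finitely many dimensions, so the
   least one is attained although there may be infinitely many subspaces. *)
pose profile := ('I_(\dim {:vT}).+1 * {ffun I -> 'I_(\dim {:vT}).+1})%type.
pose h U : profile :=
  (inord (\dim U), [ffun l => inord (\dim (V l :&: U))]).
pose gn (x : profile) l : rat :=
  (x.2 l : nat)%:R - (\dim (V l :&: B))%:R.
pose g (x : profile) : rat := ((x.1 : nat)%:R - (\dim B)%:R - \sum_l p l * gn x l)
  / (gain B T j * gn x i - gain B T i * gn x j).
have gnE U l : gn (h U) l = gain B U l.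
  by rewrite /gn /= ffunE inordK // ltnS dimvS // subvf.
have gE U : g (h U) = slack U / dl U.
  rewrite /g !gnE /= inordK ?ltnS ?dimvS ?subvf //.
  by congr ((_ - _) / _); apply: eq_bigr => l _; rewrite gnE.
have [U [BU UT lt] Umin] := ex_min_finite_image h g exbad.
have dl0 W : bad W -> 0 < dl W.
  case=> BW WT ltW; rewrite ltNge; apply/negP => le0.
  have := slack0 W BW WT; have := mulr_ge0_le0 t0_ge0 le0; lra.
have dU : 0 < dl U by exact: dl0.
pose t := slack U / dl U.
have t_ge0 : 0 <= t by rewrite divr_ge0 ?slack0 // ltW.
have tt0 : t <= t0 by rewrite ler_pdivrMr // ltW.
have tU : t * dl U = slack U by rewrite divfK // gt_eqF.
exists t; split=> //.
- by apply: q0 => //; rewrite -t0E ler_wpM2r // ltW.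
- move=> W BW WT; rewrite sumq.
  suff : t * dl W <= slack W by lra.
  have [badW|] := boolP (slack W < t0 * dl W).
    have bW : bad W by [].
    by rewrite -ler_pdivlMr ?dl0 // -gE /t -gE Umin.
  (* Outside [bad], either [t <= t0] suffices or the slack does not shrink. *)
  rewrite -leNgt => okW; have [d0|/ltW d0] := lerP 0 (dl W).
    by apply: le_trans okW; rewrite ler_wpM2r.
  by apply: le_trans (slack0 W BW WT); rewrite mulr_ge0_le0.
- right; exists U; split=> //; last by rewrite sumq tU; lra.
  rewrite !ltn_neqAle !dimvS // !andbT; apply/andP; split; apply/eqP => dimE.
    have EU : U = B by apply/eqP; rewrite eq_sym eqEdim BU dimE leqnn.
    by move: dU; rewrite /dl EU /gain; lra.
  have EU : U = T by apply/eqP; rewrite eqEdim UT dimE leqnn.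
  by move: dU; rewrite /dl EU; lra.
Qed.

(** Without gain, [V i :&: T] lies in [B]. Two points of [A] differ by [v + w] with [v] in [V i] and
    [w] in [B]; then [v] is in [T], hence in [B], and [D] has one point per coset of [B] at most. *)
Lemma card_le1_gain0 B T D (A : {set J}) i :
    {in D &, forall a b, f a - f b \in T} ->
    {in D &, forall a b, f a - f b \in B -> a = b} ->
    A \subset D -> {in A &, forall a b, f a - f b \in (V i + B)%VS} ->
    (B <= T)%VS -> gain B T i <= 0 ->
  #|A|.-1 = 0%N.
Proof.
move=> DT DB AD AV BT g0.
have capE : (V i :&: T <= B)%VS.
  have : (V i :&: B == V i :&: T)%VS.
    by rewrite eqEdim capvS //= -(ler_nat rat); move: g0; rewrite /gain; lra.
  by move/eqP <-; exact: capvSr.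
suff: (#|A| <= 1)%N by case: #|A| => [|[]].
apply/card_le1_eqP => a b Aa Ab; apply: DB; rewrite ?(subsetP AD) //.
have /memv_addP[v Vv [w Bw E]] := AV b a Ab Aa.
have fT : f b - f a \in T by rewrite DT ?(subsetP AD).
have vT' : v \in T.
  by rewrite -[v](addrK w) -E rpredB // (subvP BT).
by rewrite E rpredD // (subvP capE) // memv_cap Vv.
Qed.

(** Representing cosets of [U] by points of [D] keeps sets of cosets inside [J]. The default is
    never reached for [a] in [D]. *)
Definition coset_repr U D (a : J) : J :=
  odflt a [pick b in D | f a - f b \in U].

Lemma coset_reprP U D a : a \in D ->
  coset_repr U D a \in D /\ f a - f (coset_repr U D a) \in U.
Proof.
move=> Da; rewrite /coset_repr; case: pickP => [b /andP[]//|/(_ a)].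
by rewrite Da subrr mem0v.
Qed.

Lemma eq_coset_repr U D a b : a \in D -> f a - f b \in U ->
  coset_repr U D a = coset_repr U D b.
Proof.
move=> Da abU; rewrite /coset_repr.
have E : [pred c in D | f a - f c \in U] =1 [pred c in D | f b - f c \in U].
  move=> c /=; congr (_ && _).
  by rewrite -[f a - f c](subrKA (f b)) rpredDl.
rewrite (eq_pick E); case: pickP => [c //|/(_ a)] /=.
by rewrite Da -[f b - f a]opprB rpredN abU.
Qed.

(** Lexicographic induction: on [\dim T - \dim B], which drops when a tight subspace splits the
    problem, then on the number of active indices, which drops when a weight is exhausted. *)
Lemma weighted_incidence p B T D (S : I -> {set J}) :
    (B <= T)%VS -> (forall i, 0 <= p i) -> subcritical p B T ->
    {in D &, forall a b, f a - f b \in T} ->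
    {in D &, forall a b, f a - f b \in B -> a = b} ->
    (forall i, S i \subset D) ->
    (forall i, {in S i &, forall a b, f a - f b \in (V i + B)%VS}) ->
  \sum_i p i * (#|S i|.-1)%:R <= (#|D|.-1)%:R.
Proof.
have [N] := ubnP (\dim T - \dim B)%N.
elim: N p B T D S => // N IHN p B T D S ltN BT p0 sc DT DB SD SV.
pose act p := [set i | (0 < p i) && (0 < gain B T i)].
have [m] := ubnP #|act p|; elim: m p p0 sc => // m IHm p p0 sc ltm.
pose w i : rat := (#|S i|.-1)%:R.
have w0 i : i \notin act p -> p i * w i = 0.
  rewrite inE negb_and -!leNgt => /orP[pi|gi].
    have -> : p i = 0 by apply/eqP; rewrite eq_le pi p0.
    by rewrite mul0r.
  by rewrite /w (card_le1_gain0 DT DB (SD i) (@SV i) BT gi) mulr0.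
have [/card_le1_eqP act1|/card_gt1P[i [j [ai aj ij]]]] := leqP #|act p| 1.
  case: (set_0Vmem (act p)) => [act0|[i ai]].
    by rewrite big1 // => i _; apply: w0; rewrite act0 inE.
  rewrite (bigD1 i) //= big1 ?addr0 => [|j ji]; last first.
    by apply: w0; apply: contra ji => aj; apply/eqP; exact: act1.
  have gi : 0 < gain B T i by move: ai; rewrite inE => /andP[].
  apply: (@le_trans _ _ (w i)).
    by rewrite ler_piMl ?ler0n // (subcritical_le1 p0 sc BT gi).
  by rewrite ler_nat -!subn1 leq_sub2r // subset_leq_card.
(* By symmetry, weight moves in the direction that does not decrease the sum. *)
wlog wij : i j ai aj ij / gain B T i * w j <= gain B T j * w i.
  move=> wl; have [le|/ltW le] := lerP (gain B T i * w j) (gain B T j * w i).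
    exact: (wl i j).
  by apply: (wl j i) => //; rewrite eq_sym.
move: (ai) (aj); rewrite !inE => /andP[pi gi] /andP[pj gj].
have [t /=] := exchange_weight p0 sc ij gi gj.
set q := exchange _ _ _ _ _ => -[t0 q0 scq alt].
apply: (@le_trans _ _ (\sum_i q i * w i)).
  rewrite sum_exchange -addrA lerDl -!mulrA -mulrBr mulr_ge0 //.
  by rewrite subr_ge0.
case: alt => [qj|[U [BU UT /andP[BdU UdT] tight]]].
  (* Only [i] gains weight and it was already active, so the active set just loses [j]. *)
  apply: IHm => //; apply: (@leq_trans #|act p|) => //; apply: proper_card; apply/properP.
  split; last by exists j => //; rewrite inE qj ltxx.
  apply/subsetP => l; rewrite !inE => /andP[ql ->]; rewrite andbT.
  move: ql; rewrite /q /exchange; case: (eqVneq l i) => [->//|_].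
  by case: (eqVneq l j) => [->//|_]; rewrite !mul0r addr0 subr0.
pose r := coset_repr U D.
have rD a : a \in D -> r a \in D by move=> Da; have [] := coset_reprP U Da.
have rU a : a \in D -> f a - f (r a) \in U.
  by move=> Da; have [] := coset_reprP U Da.
have rUV a : a \in D -> f (r a) - f a \in U.
  by move=> Da; rewrite -[f _ - f a]opprB rpredN rU.
have BdT := ltn_trans BdU UdT.
have scU : subcritical q B U.
  by move=> W BW WU; apply: scq => //; exact: subv_trans WU UT.
have low j' : \sum_i q i * (#|S i :&: r @^-1: [set j']|.-1)%:R
    <= (#|D :&: r @^-1: [set j']|.-1)%:R.
  apply: (IHN q B U) => //.
  - by rewrite (leq_trans (ltn_sub2r BdT UdT)).
  - move=> a b; rewrite !inE => /andP[Da /eqP ra] /andP[Db /eqP rb].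
    rewrite -[f a - f b](subrKA (f j')) rpredD // -?ra ?rU //.
    by rewrite ra -rb rUV.
  - by move=> a b; rewrite !inE => /andP[Da _] /andP[Db _]; exact: DB.
  - by move=> i'; rewrite setSI.
  - by move=> i' a b; rewrite !inE => /andP[Sa _] /andP[Sb _]; exact: SV.
(* One representative per coset: distinct ones differ modulo [U]. *)
have high : \sum_i q i * (#|r @: S i|.-1)%:R <= (#|r @: D|.-1)%:R.
  apply: (IHN q U T) => //.
  - by rewrite (leq_trans (ltn_sub2l BdT BdU)).
  - exact: subcritical_above tight.
  - by move=> _ _ /imsetP[a Da ->] /imsetP[b Db ->]; rewrite DT ?rD.
  - move=> _ _ /imsetP[a Da ->] /imsetP[b Db ->] rab.
    apply: eq_coset_repr => //.
    rewrite -[f a - f b](subrKA (f (r a))) rpredD ?rU //.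
    by rewrite -[f (r a) - f b](subrKA (f (r b))) rpredD ?rUV.
  - by move=> i'; rewrite imsetS.
  - move=> i' _ _ /imsetP[a Sa ->] /imsetP[b Sb ->].
    have UVU := addvSr (V i') U.
    have VBU : (V i' + B <= V i' + U)%VS by rewrite addvS.
    have [Da Db] : a \in D /\ b \in D by rewrite !(subsetP (SD i')).
    rewrite -[f (r a) - _](subrKA (f a)) rpredD ?(subvP UVU _ (rUV _ _)) //.
    rewrite -[f a - f (r b)](subrKA (f b)) rpredD ?(subvP UVU _ (rU _ _)) //.
    by rewrite (subvP VBU) // SV.
rewrite (card_fibers_predn r D) natrD natr_sum.
have wE l : q l * w l = \sum_j' q l * (#|S l :&: r @^-1: [set j']|.-1)%:R
    + q l * (#|r @: S l|.-1)%:R.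
  by rewrite /w (card_fibers_predn r (S l)) natrD natr_sum mulrDr mulr_sumr.
rewrite (eq_bigr _ (fun l _ => wE l)).
rewrite big_split /= exchange_big /= lerD //.
by apply: ler_sum.
Qed.

End Incidence.

(** * From subspace designs to list decoding *)

(* Any denominator strictly between k - 1 and k would do: the design bound needs
   at least k - 1 (and a nonzero value when k = 1), while the final contradiction
   needs less than k. *)
Lemma design_subcritical (F : fieldType) (s n k L : nat)
    (H : 'I_n -> {vspace 'rV[F]_k}) (T : {vspace 'rV[F]_k}) :
    (1 <= k)%N -> (L <= s)%N -> (\dim T <= L)%N ->
    (forall l, (1 <= l <= s)%N ->
      strong_subspace_design l (l%:R * (k%:R - 1) / (s%:R - l%:R + 1)) H) ->
  subcritical H (fun=> (s%:R - L%:R + 1) / (k%:R - 2^-1)) 0%VS T.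
Proof.
move=> k1 Ls TL des U _ UT.
under eq_bigr => i _ do rewrite /gain capv0 dimv0 subr0.
rewrite dimv0 subr0 -mulr_sumr -natr_sum.
have kR : 1 <= k%:R :> rat by rewrite ler1n.
have LsR : L%:R <= s%:R :> rat by rewrite ler_nat.
have [d0|d1] := posnP (\dim U).
  rewrite big1 ?mulr0 ?ler0n // => i _.
  by have := dimvS (capvSr (H i) U); rewrite d0 leqn0 => /eqP.
have dL := leq_trans (dimvS UT) TL.
have dLR : (\dim U)%:R <= L%:R :> rat by rewrite ler_nat.
have := des (\dim U); rewrite d1 (leq_trans dL Ls) => /(_ isT U erefl).
set X := (\sum_(i < n) _)%N%:R; set d := (\dim U)%:R in dLR *.
have X0 : 0 <= X by exact: ler0n.
have dp : 0 <= d by exact: ler0n.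
rewrite ler_pdivlMr; last by lra.
move=> le; rewrite mulrAC ler_pdivrMr; last by lra.
(* As [d <= L], one weight serves every dimension. *)
have : (s%:R - L%:R + 1) * X <= X * (s%:R - d + 1).
  by rewrite mulrC ler_wpM2l //; lra.
by have : 0 <= d * 2^-1 by [rewrite mulr_ge0]; lra.
Qed.

(** Double counting of the disagreements with [y], by words and by coordinates. *)
Lemma sum_rel_dist (S : eqType) (n m : nat) (x : 'I_m -> {ffun 'I_n -> S})
    (y : {ffun 'I_n -> S}) : (1 <= n)%N ->
  n%:R * (\sum_j rel_dist (x j) y) = \sum_(i < n) (m%:R - #|[set j | x j i == y i]|%:R).
Proof.
move=> n1; rewrite mulr_sumr.
under eq_bigr => j _.
  rewrite mulrC divfK ?pnatr_eq0 -?lt0n // -sum1_card natr_sum big_mkcond /=.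
  over.
rewrite exchange_big; apply: eq_bigr => i _ /=.
have -> : (#|[set j | x j i == y i]|%:R : rat) = \sum_j (x j i == y i)%:R.
  by rewrite -sum1_card natr_sum big_mkcond; apply: eq_bigr => j _; rewrite inE; case: eqP.
have -> : (m%:R : rat) = \sum_(j < m) 1 by rewrite sumr_const card_ord.
rewrite -sumrB.
by apply: eq_bigr => j _; rewrite inE; case: eqP; rewrite ?subrr ?subr0.
Qed.

Lemma avg_radius_list_decodableW (S : eqType) (n : nat)
    (C : {pred {ffun 'I_n -> S}}) (rho : rat) (L : nat) :
  avg_radius_list_decodable C rho L -> list_decodable C rho L.
Proof.
move=> avg y cs ucs csP; rewrite leqNgt; apply/negP => ltL; apply: avg.
have mem_cs (i : 'I_L.+1) : nth y cs i \in cs.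
  by rewrite mem_nth // (leq_trans (ltn_ord i)).
exists y, (fun i : 'I_L.+1 => nth y cs i); split.
- move=> i j /eqP; rewrite nth_uniq // ?(leq_trans (ltn_ord _)) //.
  by move=> /eqP /val_inj.
- by move=> i; have [] := csP _ (mem_cs i).
- rewrite mulrC ler_pdivrMr ?ltr0n // mulr_natr.
  rewrite -[L.+1 in leRHS]card_ord -sumr_const.
  by apply: ler_sum => i _; have [] := csP _ (mem_cs i).
Qed.

Theorem theoremB5 (F : fieldType) (s n k : nat)
    (s_ge1 : (1 <= s)%N) (n_ge1 : (1 <= n)%N) (k_ge1 : (1 <= k)%N)
    (C : {vspace {ffun 'I_n -> 'rV[F]_s}})
    (enc : 'Hom('rV[F]_k, {ffun 'I_n -> 'rV[F]_s}))
    (enc_img : limg enc = C)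
    (C_design : forall l : nat, (1 <= l <= s)%N ->
       strong_subspace_designable enc l
         (l%:R * (k%:R - 1) / (s%:R - l%:R + 1)))
    (L : nat) (L_bounds : (1 <= L <= s)%N) :
  let rho : rat :=
    L%:R / (L%:R + 1) * (1 - s%:R * rate s n k / (s%:R - L%:R + 1)) in
  avg_radius_list_decodable (mem C) rho L /\ list_decodable (mem C) rho L.
Proof.
case/andP: L_bounds => L1 Ls rho.
suff avg : avg_radius_list_decodable (mem C) rho L.
  by split=> //; exact: avg_radius_list_decodableW.
case=> y [x [xinj xC le_rho]].
have ex j : exists g, x j = enc g.
  have : x j \in limg enc by rewrite enc_img; exact: xC.
  by case/memv_imgP => g _ ->; exists g.
have [f xE] := fin_all_exists ex.
pose S i := [set j | x j i == y i].
(* Differences from one base message have only [L] generators, which bounds the dimension. *)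
pose T := <<[seq f (lift ord0 j) - f ord0 | j : 'I_L]>>%VS.
have dimT : (\dim T <= L)%N.
  by apply: leq_trans (dim_span _) _; rewrite size_map size_enum_ord.
have f0T j : f j - f ord0 \in T.
  case: (unliftP ord0 j) => [j' ->|->]; last by rewrite subrr mem0v.
  by apply: memv_span; exact: image_f.
have kR : 1 <= k%:R :> rat by rewrite ler1n.
have LsR : L%:R <= s%:R :> rat by rewrite ler_nat.
have LR : 1 <= L%:R :> rat by rewrite ler1n.
have nR : 1 <= n%:R :> rat by rewrite ler1n.
have sR : 1 <= s%:R :> rat by rewrite ler1n.
set X : rat := \sum_i (#|S i|.-1)%:R.
have ub : (s%:R - L%:R + 1) * X <= L%:R * (k%:R - 2^-1).
  rewrite -ler_pdivrMr; last by lra.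
  rewrite mulrAC mulr_sumr.
  have cT : #|[set: 'I_L.+1]|.-1 = L by rewrite cardsT card_ord.
  rewrite -[X in _ <= X%:R]cT.
  apply: (weighted_incidence (f := f) (sub0v T)).
  - by move=> i; rewrite divr_ge0 //; lra.
  - exact: design_subcritical C_design.
  - move=> a b _ _; rewrite -[f a - f b](subrKA (f ord0)) rpredD //.
    by rewrite -[f ord0 - f b]opprB rpredN.
  - move=> a b _ _; rewrite memv0 subr_eq0 => /eqP fab.
    by apply: xinj; rewrite !xE fab.
  - by move=> i; exact: subsetT.
  - move=> i a b; rewrite !inE addv0 mem_coord_ker linearB /= => /eqP xa /eqP xb.
    by rewrite !ffunE -!xE xa xb subrr.
have lb : n%:R * L%:R - X <= n%:R * \sum_j rel_dist (x j) y.
  rewrite sum_rel_dist // mulr_natl -[n in _ *+ n]card_ord -sumr_const -sumrB.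
  apply: ler_sum => i _; rewrite -/(S i).
  (* Equality fails only for empty [S i], where [0.-1 = 0]. *)
  have : (#|S i|%:R : rat) <= (#|S i|.-1)%:R + 1 by rewrite natr1 ler_nat leqSpred.
  by rewrite -[L.+1%:R]natr1; lra.
have rhoE : n%:R * (L.+1%:R * rho) = n%:R * L%:R - L%:R * k%:R / (s%:R - L%:R + 1).
  rewrite /rho /rate -natr1; field.
  by apply/and4P; split; apply/eqP; lra.
move: le_rho; rewrite mulrC ler_pdivrMr ?ltr0n // [_ * L.+1%:R]mulrC.
rewrite -(ler_pM2l (_ : 0 < n%:R)); last by lra.
rewrite rhoE => le_rho.
(* The radius forces [(s - L + 1) X >= L k], whereas [ub] bounds the same product by
   [L (k - 1/2)]. *)
have : L%:R * k%:R / (s%:R - L%:R + 1) <= X by lra.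
rewrite ler_pdivrMr; last by lra.
by lra.
Qed.
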